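(* Let $m,r,n$ be integers with $0\le r\le m$ and $n\ge1$. For $0\le s\le m$ define $$P_{m,s,r}(q)=\frac{\prod_{j=0}^{s}(1-q^{m+1-j})}{(1-q)^{3s-2r}}\sum_{k=0}^{s}\frac{(-1)^{s-k}}{1-q^{m+1-k}}\left[\binom{2m-2r}{k}-\binom{2m-2r}{k-2r-2}\right]\sum_{i=0}^{s-k}\frac{m-k+1}{m-s+1}\binom{m-s+i}{i}\binom{m-k-i}{s-k-i}q^{s-k-i}.$$ Then each $P_{m,s,r}(q)\in\mathbb{Z}[q]$, and $$S_{2m-2r+1,n,r}(q)=\sum_{k=0}^{m}(-1)^kP_{m,k,r}(q)\frac{(1-q^n)^{m+1-k}(1-q^{n+1})^{m+1-k}q^{kn}}{(1-q^{2r+2})(1-q)^{2m-3k}\prod_{i=0}^{k}(1-q^{m+1-i})}.$$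
   Context: $q$ is an indeterminate and $q^{1/2}$ a fixed formal square root of $q$; identities are identities of rational functions in $q^{1/2}$. For integers $m\ge1$, $n\ge1$, $r\ge0$, $$S_{m,n,r}(q)=\sum_{k=1}^{n}\frac{1-q^{(2r+2)k}}{1-q^{2r+2}}\left(\frac{1-q^k}{1-q}\right)^{m-1}q^{\frac{m+2r+1}{2}(n-k)}.$$ Binomial coefficients $\binom{a}{b}$ with integers $a,b$ are taken to be $0$ when $b<0$ or when $0\le a<b$. *)

(* Defs.v *)
(* Rational functions in q^{1/2}: the field of fractions of
   Q[t], where t plays the role of q^{1/2} and q := t^2. *)
From mathcomp Require Import all_boot all_order all_algebra fraction.
Set Implicit Arguments. Unset Strict Implicit. Unset Printing Implicit Defensive.
Import Order.TTheory GRing.Theory Num.Theory.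
Local Open Scope ring_scope.

Definition RF : fieldType := {fraction {poly rat}}.

Definition qh : RF := @FracField.tofrac _ ('X : {poly rat}).
Definition qq : RF := qh ^+ 2.

Definition binz (a : nat) (b : int) : nat :=
  match b with Posz b' => 'C(a, b') | Negz _ => 0%N end.

Definition S_mnr (m n r : nat) : RF :=
  \sum_(1 <= k < n.+1)
     (1 - qq ^+ ((2 * r + 2) * k)) / (1 - qq ^+ (2 * r + 2))
     * ((1 - qq ^+ k) / (1 - qq)) ^+ (m - 1)
     * qh ^+ ((m + 2 * r + 1) * (n - k)).

Definition P_msr (m s r : nat) : RF :=
  (\prod_(j < s.+1) (1 - qq ^+ (m.+1 - j)))
  / (1 - qq) ^ ((3 * s)%:Z - (2 * r)%:Z)
  * \sum_(k < s.+1)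
      ((-1) ^+ (s - k) / (1 - qq ^+ (m.+1 - k))
       * (('C(2 * m - 2 * r, k))%:R
          - (binz (2 * m - 2 * r) (k%:Z - (2 * r + 2)%:Z))%:R)
       * \sum_(i < (s - k).+1)
           ((m - k + 1)%:R / (m - s + 1)%:R
            * ('C(m - s + i, i))%:R * ('C(m - k - i, s - k - i))%:R
            * qq ^+ (s - k - i))).

(* Main.v *)
Require Import Defs.
From mathcomp Require Import all_boot all_order all_algebra fraction ring zify.
Import Order.TTheory GRing.Theory Num.Theory.
Set Implicit Arguments. Unset Strict Implicit. Unset Printing Implicit Defensive.
Local Open Scope ring_scope.

(* The Laurent polynomial (1 - x^(2r+2)) (1 - x)^(2m-2r) x^(-m-1) is
   antisymmetric under x -> 1/x, so summing it over x = q, ..., q^n produces the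
   products (1 - q^(an)) (1 - q^(a(n+1))) with a = m+1-k.  By the Lucas-type
   identity
     (1 - x^a)(1 - y^a) = sum_(t < a) ((1-x)(1-y))^(a-t) psi_(a-t,t)(x, y),
   where psi_(j,n) = [z^n] (1 - xyz^2) / ((1 - xz)(1 - yz))^(j+1), each of them is
   a combination of powers of (1 - q^n)(1 - q^(n+1)); this is the formula.
   For integrality, the sum over j is visibly divisible by (1-q)^(2m-2r+1) for every
   n.  Since (1 - q^n)(1 - q^(n+1)) vanishes exactly to order 2 at q = 1, with
   leading coefficient n(n+1), and the powers of n(n+1) are linearly independent
   as functions of n, no cancellation is possible between the summands, and each
   coefficient has to be divisible by its own power of 1-q. *)

(** * Truncated power series in z and the Lucas-type identity for (1 - x^a)(1 - y^a) *)

Section TruncatedSeries.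

Variable R : comNzRingType.
Implicit Types (p q : {poly R}) (x y : R).

Definition eq_upto (N : nat) p q := forall i, (i < N)%N -> p`_i = q`_i.

Lemma eq_upto_refl N p : eq_upto N p p. Proof. by []. Qed.

Lemma eq_upto_eq N p q : p = q -> eq_upto N p q. Proof. by move=> ->. Qed.

Lemma eq_upto_sym N p q : eq_upto N p q -> eq_upto N q p.
Proof. by move=> pq i iN; rewrite pq. Qed.

Lemma eq_upto_trans N q p p' : eq_upto N p q -> eq_upto N q p' -> eq_upto N p p'.
Proof. by move=> pq qp i iN; rewrite pq ?qp. Qed.

Lemma eq_uptoD N p q p' q' :
  eq_upto N p q -> eq_upto N p' q' -> eq_upto N (p + p') (q + q').
Proof. by move=> pq pq' i iN; rewrite !coefD pq ?pq'. Qed.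

Lemma eq_uptoM N p q p' q' :
  eq_upto N p q -> eq_upto N p' q' -> eq_upto N (p * p') (q * q').
Proof.
move=> pq pq' i iN; rewrite !coefM; apply: eq_bigr => k _.
rewrite pq ?pq' //; first exact: leq_ltn_trans (leq_subr _ _) iN.
by apply: leq_ltn_trans iN; rewrite -ltnS.
Qed.

(** A series with constant term 1 is invertible: once the lower coefficients agree, the first term
    of the convolution settles the next one. *)
Lemma eq_upto_mul2l N (e : {poly R}) p q :
  e`_0 = 1 -> eq_upto N (e * p) (e * q) -> eq_upto N p q.
Proof.
move=> e0 epq i; elim/ltn_ind: i => i IH iN.
have := epq i iN; rewrite !coefM !big_ord_recl /= e0 !mul1r subn0.
rewrite (eq_bigr (fun k : 'I_i => e`_(lift ord0 k) * q`_(i - lift ord0 k))).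
  by move/addIr.
move=> k _; congr (_ * _).
have ki : (i - lift ord0 k < i)%N.
  by rewrite ltn_subrL lift0 /= (leq_ltn_trans _ (ltn_ord k)).
by rewrite IH // (ltn_trans ki).
Qed.

(* [(1 - xz)^(-j)] modulo [z^N]; the truncated predecessor is harmless at [j = 0]
   because ['C(i.-1, i) = 0] for [i > 0]. *)
Definition negbin (N j : nat) x : {poly R} :=
  \poly_(i < N) (x ^+ i *+ 'C((j + i).-1, i)).

Lemma negbin0 N x : eq_upto N (negbin N 0 x) 1.
Proof.
move=> i iN; rewrite coef_poly iN coef1 add0n.
by case: i iN => [|i] iN //=; rewrite bin_small.
Qed.

Lemma coef_1subZX x p i :
  ((1 - x *: 'X) * p)`_i = p`_i - x * (if i is i'.+1 then p`_i' else 0).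
Proof.
by rewrite mulrBl mul1r -scalerAl coefB coefZ coefXM; case: i.
Qed.

Lemma negbinS N j x :
  eq_upto N ((1 - x *: 'X) * negbin N j.+1 x) (negbin N j x).
Proof.
move=> i iN; rewrite coef_1subZX; case: i iN => [|i] iN.
  by rewrite !coef_poly iN mulr0 subr0 !bin0.
rewrite !coef_poly iN (ltnW iN) addSn addnS /= binS mulrnDr exprS mulrnAr addrK.
by [].
Qed.

Lemma negbin_deriv N j x :
  eq_upto N ('X * (negbin N j x)^`()) ((x *: 'X * negbin N j.+1 x) *+ j).
Proof.
move=> i iN; rewrite coefMn -scalerAl coefZ ![_`_i]coefXM; case: i iN => [|i] iN /=.
  by rewrite mulr0 mul0rn.
rewrite coef_deriv !coef_poly iN (ltnW iN) addSn addnS /=.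
rewrite mulrnAr -exprS -!mulrnA; congr (_ *+ _).
by rewrite mulnC mul_bin_left addnK mulnC.
Qed.

(** Partial fractions 1/(1-xz) + 1/(1-yz) - 1 = (1-xyz^2)/((1-xz)(1-yz)), cleared of denominators.
    For a > 0 the coefficient of z^a on the left is x^a + y^a. *)
Lemma negbin1_pair N x y :
  eq_upto N ((1 - x *: 'X) * (1 - y *: 'X) * (negbin N 1 x + negbin N 1 y - 1))
    (1 - (x * y) *: 'X^2).
Proof.
have H z := eq_upto_trans (@negbinS N 0 z) (@negbin0 N z).
apply: (@eq_upto_trans _ ((1 - y *: 'X) * 1 + (1 - x *: 'X) * 1
   - (1 - x *: 'X) * (1 - y *: 'X))); last first.
  apply: eq_upto_eq; rewrite -!mul_polyC polyCM; ring.
have -> : (1 - x *: 'X) * (1 - y *: 'X) * (negbin N 1 x + negbin N 1 y - 1) =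
  (1 - y *: 'X) * ((1 - x *: 'X) * negbin N 1 x)
  + (1 - x *: 'X) * ((1 - y *: 'X) * negbin N 1 y)
  - (1 - x *: 'X) * (1 - y *: 'X) by ring.
apply: eq_uptoD; last exact: eq_upto_refl.
by apply: eq_uptoD; apply: eq_uptoM => //; apply: H.
Qed.

Definition negbin2 N j x y := negbin N j x * negbin N j y.

Lemma negbin2S N j x y :
  eq_upto N ((1 - x *: 'X) * (1 - y *: 'X) * negbin2 N j.+1 x y) (negbin2 N j x y).
Proof.
by rewrite mulrACA; apply: eq_uptoM; apply: negbinS.
Qed.

(** With D = (1-xz)(1-yz), applying j + z d/dz to D^(-j) gives j (D - zD') D^(-j-1), and D - zD' = 1
    - xyz^2. *)
Lemma negbin2_deriv N j x y :
  eq_upto N (negbin2 N j x y *+ j + 'X * (negbin2 N j x y)^`())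
    (((1 - (x * y) *: 'X^2) * negbin2 N j.+1 x y) *+ j).
Proof.
rewrite derivM mulrDr.
rewrite (_ : 'X * _ = ('X * (negbin N j x)^`()) * negbin N j y); last by ring.
rewrite (_ : 'X * (_ * _) = negbin N j x * ('X * (negbin N j y)^`())); last by ring.
apply: (@eq_upto_trans _ (
  ((1 - x *: 'X) * (1 - y *: 'X) * negbin2 N j.+1 x y) *+ j
  + ((x *: 'X * negbin N j.+1 x *+ j) * ((1 - y *: 'X) * negbin N j.+1 y)
  + ((1 - x *: 'X) * negbin N j.+1 x) * (y *: 'X * negbin N j.+1 y *+ j)))).
  apply: eq_uptoD.
    by move=> i iN; rewrite !coefMn negbin2S.
  apply: eq_uptoD; apply: eq_uptoM;
    by [apply: negbin_deriv | apply: eq_upto_sym; apply: negbinS].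
apply: eq_upto_eq; rewrite /negbin2 -!mul_polyC polyCM mulrnAl mulrnAr -!mulrnDl.
congr (_ *+ j); ring.
Qed.

(* The coefficient of [z^n] in [(1 - xyz^2) / ((1 - xz)(1 - yz))^(j+1)]. *)
Definition psi j n x y :=
  ((1 - (x * y) *: 'X^2) * negbin2 n.+1 j.+1 x y)`_n.

Lemma negbin_widen N j x i : (i < N)%N -> eq_upto i.+1 (negbin N j x) (negbin i.+1 j x).
Proof. by move=> iN k ki; rewrite !coef_poly ki (leq_ltn_trans _ iN). Qed.

Lemma coef_psi N j n x y : (n < N)%N ->
  ((1 - (x * y) *: 'X^2) * negbin2 N j.+1 x y)`_n = psi j n x y.
Proof.
move=> nN; apply: (@eq_uptoM n.+1) => //.
by apply: eq_uptoM; apply: negbin_widen.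
Qed.

(** Coefficient of z^n in [negbin2_deriv], where z d/dz acts as multiplication by n. The factor j
    stays on the left because the ring need not allow division. *)
Lemma mulrn_psi j n x y :
  psi j n x y *+ j =
  (\sum_(i < n.+1) x ^+ i *+ 'C((j + i).-1, i) *
      (y ^+ (n - i) *+ 'C((j + (n - i)).-1, n - i))) *+ (j + n).
Proof.
have := @negbin2_deriv n.+1 j x y n (ltnSn n).
rewrite coefD !coefMn -/(psi j n x y) => <-.
rewrite coefXM mulrnDr.
have -> : (negbin2 n.+1 j x y)`_n = \sum_(i < n.+1) x ^+ i *+ 'C((j + i).-1, i) *
      (y ^+ (n - i) *+ 'C((j + (n - i)).-1, n - i)).
  rewrite /negbin2 coefM; apply: eq_bigr => i _.
  by rewrite !coef_poly ltn_ord ltnS leq_subr.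
congr (_ + _); case: n => [|n] /=; first by rewrite mulr0n.
rewrite coef_deriv; congr (_ *+ _).
rewrite coefM; apply: eq_bigr => i _.
by rewrite !coef_poly ltn_ord ltnS leq_subr.
Qed.

(** Geometric series in uz/D with D = (1-xz)(1-yz): multiplication by D - uz telescopes. *)
Lemma telescope_negbin2 N k u x y :
  eq_upto N (((1 - x *: 'X) * (1 - y *: 'X) - u *: 'X)
     * \sum_(j < k) (u *: 'X) ^+ j * negbin2 N j.+1 x y)
    (1 - (u *: 'X) ^+ k * negbin2 N k x y).
Proof.
elim: k => [|k IH].
  rewrite big_ord0 mulr0 expr0 mul1r => i iN.
  have /(_ i iN) := eq_uptoM (@negbin0 N x) (@negbin0 N y).
  by rewrite -/(negbin2 _ _ _ _) coefB => ->; rewrite mulr1 coef0 subrr.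
rewrite big_ord_recr /= mulrDr.
apply: eq_upto_trans (eq_uptoD IH (@eq_upto_refl _ _)) _.
have -> : 1 - (u *: 'X) ^+ k.+1 * negbin2 N k.+1 x y =
  1 - (u *: 'X) ^+ k * negbin2 N k x y + ((u *: 'X) ^+ k * negbin2 N k x y
    - (u *: 'X) ^+ k.+1 * negbin2 N k.+1 x y) by ring.
apply: eq_uptoD => //.
have -> : ((1 - x *: 'X) * (1 - y *: 'X) - u *: 'X) * ((u *: 'X) ^+ k * negbin2 N k.+1 x y)
  = (u *: 'X) ^+ k * ((1 - x *: 'X) * (1 - y *: 'X) * negbin2 N k.+1 x y)
   - (u *: 'X) ^+ k.+1 * negbin2 N k.+1 x y by rewrite exprS; ring.
apply: eq_uptoD => //; apply: eq_uptoM => //; exact: negbin2S.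
Qed.

Lemma coef_ZXnM (u : R) j p n : (j <= n)%N -> ((u *: 'X) ^+ j * p)`_n = u ^+ j * p`_(n - j).
Proof.
by move=> jn; rewrite exprZn -scalerAl coefZ coefXnM ltnNge jn.
Qed.

(** For u = (1-x)(1-y), D - uz = (1-z)(1-xyz). Hence (1-xyz^2)/(D-uz) has z^a-coefficient 1 +
    (xy)^a, while its expansion in powers of uz/D gives x^a + y^a at j = 0 and the [psi] terms for j
    > 0. *)
Lemma sum_psi a x y : (0 < a)%N ->
  (1 - x ^+ a) * (1 - y ^+ a) =
  \sum_(t < a) ((1 - x) * (1 - y)) ^+ (a - t) * psi (a - t) t x y.
Proof.
move=> a0; set u := (1 - x) * (1 - y).
set N := a.+1; set E := (1 - x *: 'X) * (1 - y *: 'X) - u *: 'X : {poly R}.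
have EE : E = (1 - 1 *: 'X) * (1 - (x * y) *: 'X).
  rewrite /E /u -!mul_polyC !rmorphM !rmorphB !rmorph1 /=; ring.
have W : eq_upto N (E * ((1 - (x * y) *: 'X^2)
    * \sum_(j < N) (u *: 'X) ^+ j * negbin2 N j.+1 x y)) (1 - (x * y) *: 'X^2).
  rewrite mulrCA -[X in eq_upto _ _ X]mulr1; apply: eq_uptoM => //.
  apply: eq_upto_trans (@telescope_negbin2 _ _ _ _ _) _.
  (* With N terms, the telescoping remainder (uz)^N lies beyond the truncation order. *)
  by move=> i iN; rewrite coefB exprZn -scalerAl coefZ coefXnM iN mulr0 subr0.
have V : eq_upto N (E * (negbin N 1 1 + negbin N 1 (x * y) - 1)) (1 - (x * y) *: 'X^2).
  by rewrite EE -{3}[x * y]mul1r; apply: negbin1_pair.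
have E0 : E`_0 = 1.
  by rewrite -horner_coef0 /E !hornerE; ring.
have V0 z : (negbin N 1 z)`_a = z ^+ a by rewrite coef_poly ltnSn add1n binn.
have := eq_upto_mul2l E0 (eq_upto_trans W (eq_upto_sym V)) (ltnSn a).
rewrite coefB coefD coef1 !V0 (gtn_eqF a0) subr0 expr1n.
rewrite mulr_sumr coef_sum big_ord_recl /= expr0 mul1r.
have D0 : ((1 - x *: 'X) * (1 - y *: 'X))`_0 = 1 :> R.
  by rewrite -horner_coef0 !hornerE; ring.
have -> : ((1 - (x * y) *: 'X^2) * negbin2 N 1 x y)`_a = x ^+ a + y ^+ a.
  have H : eq_upto N ((1 - x *: 'X) * (1 - y *: 'X) *
     ((1 - (x * y) *: 'X^2) * negbin2 N 1 x y)) (1 - (x * y) *: 'X^2).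
    rewrite mulrCA -[X in eq_upto _ _ X]mulr1; apply: eq_uptoM => //.
    apply: eq_upto_trans (@negbin2S _ _ _ _) _.
    by rewrite -[1]mulr1; apply: eq_uptoM; apply: negbin0.
  have := eq_upto_mul2l D0 (eq_upto_trans H (eq_upto_sym (@negbin1_pair N x y))) (ltnSn a).
  by move=> ->; rewrite coefB coefD coef1 !V0 (gtn_eqF a0) subr0.
move=> H.
have -> : (1 - x ^+ a) * (1 - y ^+ a) = (1 + (x * y) ^+ a) - (x ^+ a + y ^+ a).
  by rewrite exprMn; ring.
(* Reversal sets j = a - t: the power (uz)^j contributes u^j times the coefficient of z^t. *)
rewrite -H [x ^+ a + y ^+ a + _]addrC addrK (reindex_inj rev_ord_inj) /=.
apply: eq_bigr => t _.
rewrite mulrCA /bump leq0n add1n -subSn // subSS coef_ZXnM ?leq_subr // subKn ?coef_psi // -/N.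
- by rewrite ltnS ltnW.
- exact: ltnW.
Qed.

Lemma coefM_scaled (c : R) p p' q q' :
    (forall i, p`_i = c ^+ i * q`_i) -> (forall i, p'`_i = c ^+ i * q'`_i) ->
  forall i, (p * p')`_i = c ^+ i * (q * q')`_i.
Proof.
move=> pq pq' i; rewrite !coefM mulr_sumr; apply: eq_bigr => k _.
by rewrite pq pq' mulrACA -exprD subnKC // -ltnS.
Qed.

(** The generating series depends on x and y only through xz and yz, so its z^n-coefficient is
    homogeneous of degree n. This extracts q^n from the pair (q^n, q^(n+1)). *)
Lemma psi_scaled c j n x y : psi j n (c * x) (c * y) = c ^+ n * psi j n x y.
Proof.
have H z N k : forall i, (negbin N k (c * z))`_i = c ^+ i * (negbin N k z)`_i.
  move=> i; rewrite !coef_poly; case: ifP => _; last by rewrite mulr0.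
  by rewrite exprMn mulrnAr.
apply: coefM_scaled; last exact: coefM_scaled.
move=> i; rewrite !coefB !coefZ coefXn coef1.
case: i => [|[|[|i]]] /=; rewrite ?expr0; ring.
Qed.

End TruncatedSeries.

(** * The antisymmetric polynomial (1 - x^(2r+2)) (1-x)^(2m-2r) and its sum over powers of q *)

(** Up to the sign (-1)^k, the coefficient of x^k in that polynomial; the shift 2r+2 is even, so
    both binomials carry the same sign. *)
Definition cfaul (m r k : nat) : int :=
  ('C(2 * m - 2 * r, k))%:R - (binz (2 * m - 2 * r) (k%:Z - (2 * r + 2)%:Z))%:R.

Lemma binz_shift a b k : (k < b)%N -> binz a (k%:Z - b%:Z) = 0%N.
Proof.
move=> kb; rewrite (_ : k%:Z - b%:Z = Negz (b - k).-1) //; lia.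
Qed.

(** By symmetry of binomial coefficients, k -> 2m+2-k swaps the two binomials. *)
Lemma cfaul_antisym m r k : (r <= m)%N -> (k <= 2 * m + 2)%N ->
  cfaul m r (2 * m + 2 - k) = - cfaul m r k.
Proof.
move=> rm km; rewrite /cfaul.
have H j : (j <= 2 * m + 2)%N ->
  binz (2 * m - 2 * r) (j%:Z - (2 * r + 2)%:Z) = 'C(2 * m - 2 * r, 2 * m + 2 - j).
  move=> jm; case: (ltnP j (2 * r + 2)) => jr.
    by rewrite binz_shift // bin_small //; lia.
  rewrite subzn //=; case: (leqP (j - (2 * r + 2)) (2 * m - 2 * r)) => jj.
    by rewrite -bin_sub //; congr 'C(_, _); lia.
  by lia.
by rewrite !H ?leq_subr // subKn // opprB.
Qed.

Lemma faul_poly (R : comNzRingType) m r (x : R) : (r <= m)%N ->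
  (1 - x ^+ (2 * r + 2)) * (1 - x) ^+ (2 * m - 2 * r) =
  \sum_(0 <= k < (2 * m + 2).+1) (-1) ^+ k * (cfaul m r k)%:~R * x ^+ k.
Proof.
move=> rm.
(* The padding j adds only zero terms, so that the unshifted expansion can run up to degree 2m+2. *)
have E j : (1 - x) ^+ (2 * m - 2 * r) =
   \sum_(0 <= k < (2 * m - 2 * r).+1 + j)
      (-1) ^+ k * ('C(2 * m - 2 * r, k))%:R * x ^+ k.
  rewrite exprBn (big_cat_nat (n := (2 * m - 2 * r).+1)) //=; last by lia.
  rewrite [X in _ + X]big_nat [X in _ + X]big1 ?addr0; last first => [k /andP[k1 k2]|].
    by rewrite bin_small // mulr0 mul0r.
  rewrite big_mkord; apply: eq_bigr => i _.
  by rewrite expr1n mulr1 mulr_natr mulrnAl.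
rewrite mulrBl mul1r {1}(E (2 * r + 2)%N) (E 0%N) addn0 mulr_sumr.
rewrite (_ : _ + _ = (2 * m + 2).+1)%N; last by lia.
rewrite -[\sum_(0 <= i < (2 * m - 2 * r).+1) _](_ : \sum_(0 <= k < (2 * m + 2).+1)
   (-1) ^+ k * (binz (2 * m - 2 * r) (k%:Z - (2 * r + 2)%:Z))%:R * x ^+ k = _).
  rewrite -sumrB; apply: eq_bigr => k _.
  by rewrite /cfaul rmorphB /= !rmorph_nat; ring.
rewrite (big_cat_nat (n := (2 * r + 2)%N)) //=; last by lia.
rewrite big_nat [X in X + _]big1 ?add0r; last first => [k /andP[k1 k2]|].
  by rewrite binz_shift // mulr0 mul0r.
rewrite -{1}[(2 * r + 2)%N]add0n big_addn.
rewrite (_ : _ - _ = (2 * m - 2 * r).+1)%N; last by lia.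
apply: eq_bigr => k _.
rewrite PoszD addrK /= exprD [(-1) ^+ (2 * r + 2)]exprD exprM sqrrN !expr1n.
by rewrite [x ^+ (k + _)]exprD; ring.
Qed.

Lemma faul_poly_fold (R : comNzRingType) m r (x : R) : (r <= m)%N ->
  (1 - x ^+ (2 * r + 2)) * (1 - x) ^+ (2 * m - 2 * r) =
  \sum_(k < m.+1) (-1) ^+ k * (cfaul m r k)%:~R * (x ^+ k - x ^+ (2 * m + 2 - k)).
Proof.
move=> rm; rewrite faul_poly // (big_cat_nat (n := m.+1)) //=; last by lia.
rewrite [X in _ + X]big_ltn; last by lia.
(* The fixed point k = m+1 of k -> 2m+2-k has a coefficient equal to its own negative. *)
have c0 : cfaul m r m.+1 = 0.
  have : cfaul m r (2 * m + 2 - m.+1) = - cfaul m r m.+1 by rewrite cfaul_antisym; lia.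
  rewrite (_ : 2 * m + 2 - m.+1 = m.+1)%N; last by lia.
  by move: (cfaul m r m.+1) => c; lia.
rewrite c0 mulr0 mul0r add0r.
have -> : \sum_(m.+2 <= k < (2 * m + 2).+1) (-1) ^+ k * (cfaul m r k)%:~R * x ^+ k
  = \sum_(0 <= k < m.+1) (-1) ^+ k * - (cfaul m r k)%:~R * x ^+ (2 * m + 2 - k).
  rewrite big_nat_rev /= -{1}[m.+2]add0n big_addn.
  rewrite (_ : _ - _ = m.+1)%N; last by lia.
  rewrite !big_nat; apply: eq_bigr => k /andP[_ km].
  rewrite (_ : _ - _ = 2 * m + 2 - k)%N; last by lia.
  rewrite cfaul_antisym //; last by lia.
  rewrite rmorphN /=; congr (_ * _ * _).
  rewrite -signr_odd -[RHS]signr_odd; congr (_ ^+ nat_of_bool _); lia.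
rewrite -big_split /= big_mkord; apply: eq_bigr => k _; ring.
Qed.

(** The q-integer (1-q^n)/(1-q), written as a sum so that it exists in any commutative ring and can
    be evaluated at q = 1. *)
Definition qint (R : comNzRingType) (q : R) n : R := \sum_(i < n) q ^+ i.

Lemma mul_qint (R : comNzRingType) (q : R) n : (1 - q) * qint q n = 1 - q ^+ n.
Proof. by rewrite -[1 - q ^+ n]opprB subrX1 -mulNr opprB. Qed.

(** With a = m+1-k and x = q^j, the two folded monomials become q^(kn) q^(a(n-j)) and q^(kn)
    q^(a(n+j)): two geometric progressions in q^a with a common sum. *)
Lemma faul_sum (R : comNzRingType) m r n (q : R) : (r <= m)%N ->
  \sum_(1 <= j < n.+1) (1 - q ^+ ((2 * r + 2) * j)) * (1 - q ^+ j) ^+ (2 * m - 2 * r)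
     * q ^+ (m.+1 * (n - j)) =
  \sum_(k < m.+1) (-1) ^+ k * (cfaul m r k)%:~R * q ^+ (k * n)
     * qint (q ^+ (m.+1 - k)) n * (1 - q ^+ ((m.+1 - k) * n.+1)).
Proof.
move=> rm.
under eq_bigr => j _ do rewrite mulnC exprM faul_poly_fold // mulr_suml.
rewrite exchange_big /=; apply: eq_bigr => k _.
under eq_bigr => j _ do rewrite -mulrA.
rewrite -mulr_sumr -!mulrA; congr (_ * (_ * _)).
rewrite (big_addn 0 n.+1 1) subn1 /=.
rewrite (eq_big_nat _ _ (F2 := fun j : nat => q ^+ (k * n) * q ^+ ((m.+1 - k) * (n - j.+1))
   - q ^+ (k * n) * (q ^+ ((m.+1 - k) * n.+1) * q ^+ ((m.+1 - k) * j)))).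
  rewrite sumrB -!mulr_sumr [X in _ * X - _]big_nat_rev /= !big_mkord add0n.
  rewrite (_ : qint _ n = \sum_(i < n) q ^+ ((m.+1 - k) * i)); last first.
    by apply: eq_bigr => i _; rewrite exprM.
  rewrite (eq_bigr (fun i : 'I_n => q ^+ ((m.+1 - k) * i))) => [|i _]; first by ring.
  by congr (_ ^+ (_ * _)); have := ltn_ord i; lia.
move=> j /andP[_ jn]; have := ltn_ord k; move: (nat_of_ord k) => {}k km.
rewrite addn1 mulrBl -!exprM -!exprD; congr (_ ^+ _ - _ ^+ _).
  (* Writing n and m as sums removes the truncated subtractions before [nia]. *)
  have [d ->] : exists d, n = (j.+1 + d)%N by exists (n - j.+1)%N; lia.
  have [e ->] : exists e, m = (k + e)%N by exists (m - k)%N; lia.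
  rewrite (_ : (k + e).+1 - k = e.+1)%N; last lia.
  rewrite addKn; nia.
have [d ->] : exists d, n = (j.+1 + d)%N by exists (n - j.+1)%N; lia.
have [e ->] : exists e, m = (k + e)%N by exists (m - k)%N; lia.
rewrite (_ : (k + e).+1 - k = e.+1)%N; last lia.
rewrite (_ : 2 * (k + e) + 2 - k = k + 2 * e.+1)%N; last lia.
rewrite addKn; nia.
Qed.

(** * Division-free numerators and the summation formula over a commutative ring *)

Section FaulhaberNumerators.

Variables (R : comNzRingType) (q : R).

(** [P_msr] up to a power of 1 - q. Dropping j = k from the product absorbs the denominator 1 -
    q^(m+1-k), so the definition makes sense over Z[q]. *)
Definition faulnum m r s : R :=
  \sum_(k < s.+1) (-1) ^+ (s - k) * (cfaul m r k)%:~R * psi (m.+1 - s) (s - k) 1 q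
    * \prod_(0 <= j < s.+1 | j != k) qint q (m.+1 - j).

(** [sum_psi] at (q^n, q^(n+1)) with a = m+1-k and t = s-k; homogeneity yields q^(n(s-k)), which
    q^(kn) completes to q^(sn). *)
Lemma sum_faulnum_term m k n : (k <= m)%N ->
  (1 - q ^+ (n * (m.+1 - k))) * (1 - q ^+ (n.+1 * (m.+1 - k))) * q ^+ (k * n) =
  \sum_(s < m.+1 | (k <= s)%N) ((1 - q ^+ n) * (1 - q ^+ n.+1)) ^+ (m.+1 - s)
     * psi (m.+1 - s) (s - k) 1 q * q ^+ (s * n).
Proof.
move=> km; rewrite !exprM sum_psi ?subn_gt0 ?ltnS // mulr_suml.
rewrite -(big_geq_mkord k m.+1 xpredT (fun s => ((1 - q ^+ n) * (1 - q ^+ n.+1)) ^+ (m.+1 - s)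
     * psi (m.+1 - s) (s - k) 1 q * q ^+ (s * n))).
have shift (F : nat -> R) : \sum_(k <= s < m.+1) F s = \sum_(t < m.+1 - k) F (t + k)%N.
  by rewrite -{1}[k]add0n big_addn big_mkord.
rewrite shift; apply: eq_bigr => t _.
rewrite addnK -subnDA [(k + t)%N]addnC.
have -> : psi (m.+1 - (t + k)) t (q ^+ n) (q ^+ n.+1) =
    psi (m.+1 - (t + k)) t (q ^+ n * 1) (q ^+ n * q) by rewrite mulr1 exprSr.
by rewrite psi_scaled mulnDl exprD [(t * n)%N]mulnC !exprM; ring.
Qed.

(** Each term of [faul_sum] is expanded over a common denominator; exchanging the sums collects the
    k <= s into [faulnum], with the factors j > s common to all of them. *)
Lemma sum_faulnum m r n : (r <= m)%N ->
  (1 - q) * \prod_(0 <= j < m.+1) qint q (m.+1 - j)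
  * (\sum_(1 <= j < n.+1) (1 - q ^+ ((2 * r + 2) * j)) * (1 - q ^+ j) ^+ (2 * m - 2 * r)
     * q ^+ (m.+1 * (n - j))) =
  \sum_(s < m.+1) (-1) ^+ s * q ^+ (s * n)
    * ((1 - q ^+ n) * (1 - q ^+ n.+1)) ^+ (m.+1 - s)
    * (faulnum m r s * \prod_(s.+1 <= j < m.+1) qint q (m.+1 - j)).
Proof.
move=> rm; rewrite faul_sum // mulr_sumr.
transitivity (\sum_(k < m.+1) \sum_(s < m.+1 | (k <= s)%N)
  (-1) ^+ k * (cfaul m r k)%:~R * \prod_(0 <= j < m.+1 | j != k) qint q (m.+1 - j)
  * (((1 - q ^+ n) * (1 - q ^+ n.+1)) ^+ (m.+1 - s)
     * psi (m.+1 - s) (s - k) 1 q * q ^+ (s * n))).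
  apply: eq_bigr => k _; rewrite -mulr_sumr -sum_faulnum_term -1?ltnS //.
  rewrite !big_mkord (bigD1 k) //=.
  (* The prefactor 1 - q and the k-th factor of the product complete the geometric sum in
     q^(m+1-k). *)
  have -> : 1 - q ^+ (n * (m.+1 - k)) = (1 - q) * qint q (m.+1 - k) * qint (q ^+ (m.+1 - k)) n.
    by rewrite mul_qint mul_qint mulnC exprM.
  by rewrite [(n.+1 * _)%N]mulnC; ring.
rewrite (exchange_big_dep xpredT) //=; apply: eq_bigr => s _.
rewrite /faulnum !(mulr_suml, mulr_sumr).
rewrite (big_ord_widen _ (fun k : nat => (-1) ^+ s * q ^+ (s * n)
    * ((1 - q ^+ n) * (1 - q ^+ n.+1)) ^+ (m.+1 - s)
    * ((-1) ^+ (s - k) * (cfaul m r k)%:~R * psi (m.+1 - s) (s - k) 1 q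
       * \prod_(0 <= j < s.+1 | j != k) qint q (m.+1 - j)
       * \prod_(s.+1 <= j < m.+1) qint q (m.+1 - j))) (ltn_ord s)).
apply: eq_bigr => k ks.
have -> : \prod_(0 <= j < m.+1 | j != k) qint q (m.+1 - j) =
   \prod_(0 <= j < s.+1 | j != k) qint q (m.+1 - j) *
   \prod_(s.+1 <= j < m.+1) qint q (m.+1 - j).
  rewrite (big_cat_nat (n := s.+1)) //=; congr (_ * _).
  rewrite big_nat_cond [RHS]big_nat_cond; apply: eq_bigl => j.
  by rewrite andbT; case: (s < j < m.+1)%N / andP => // -[sj _]; apply/eqP; lia.
have -> : (-1) ^+ k = (-1) ^+ s * (-1) ^+ (s - k) :> R.
  by rewrite -{1}(subnKC ks) exprD -mulrA -expr2 sqrr_sign mulr1.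
ring.
Qed.

End FaulhaberNumerators.

(** * Divisibility of the numerators by powers of 1 - q in Z[q] *)

Lemma horner1_qint n : (qint 'X n : {poly int}).[1] = n%:R.
Proof.
rewrite /qint horner_sum (eq_bigr (fun _ => 1)) ?sumr_const ?card_ord //.
by move=> i _; rewrite hornerXn expr1n.
Qed.

Lemma subX_neq0 : 1 - 'X != 0 :> {poly int}.
Proof. by rewrite -opprB oppr_eq0 polyXsubC_eq0. Qed.

(** The numbers n(n+1) with n > 0 are pairwise distinct, so p has more roots than its degree
    allows. *)
Lemma pronic_roots_eq0 (p : {poly int}) :
  (forall n, (0 < n)%N -> p.[n%:R * n.+1%:R] = 0) -> p = 0.
Proof.
move=> H; apply: (@roots_geq_poly_eq0 _ p [seq n%:R * n.+1%:R | n <- iota 1 (size p)]).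
- by apply/allP => x /mapP[n]; rewrite mem_iota => /andP[n0 _] ->; apply/rootP/H.
- rewrite map_inj_uniq ?iota_uniq // => a b; rewrite -!natrM => /eqP.
  rewrite eqr_nat => /eqP; nia.
- by rewrite size_map size_iota.
Qed.

(** Induction on the power e of 1 - q, for all s at once. Dividing the sums by (1-q)^e and setting q
    = 1 leaves a polynomial in n(n+1) that vanishes for all n > 0. Its coefficients are, up to sign,
    the quotients at 1 times the nonzero [(M s).[1]], so each quotient has a further factor 1 -
    q. *)
Lemma dvd_of_pronic_sums m E (V M : nat -> {poly int}) :
    (forall s, (M s).[1] != 0) ->
    (forall n, (0 < n)%N -> exists K, \sum_(s < m.+1) (-1) ^+ s * 'X ^+ (s * n)
      * ((1 - 'X ^+ n) * (1 - 'X ^+ n.+1)) ^+ (m.+1 - s) * (V s * M s)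
       = (1 - 'X) ^+ E * K) ->
  forall s, (s <= m)%N -> exists W, (1 - 'X) ^+ (2 * (m.+1 - s)) * V s = (1 - 'X) ^+ E * W.
Proof.
move=> M0 H s sm.
suff /(_ E (leqnn E) (Ordinal (sm : (s < m.+1)%N))) : forall e, (e <= E)%N -> forall s : 'I_m.+1,
  exists W, (1 - 'X) ^+ (2 * (m.+1 - s)) * V s = (1 - 'X) ^+ e * W by [].
elim=> [|e IH] eE; first by move=> i; eexists; rewrite expr0 mul1r.
have [f fE] := fin_all_exists (IH (ltnW eE)).
suff f1 i : (f i).[1] = 0.
  move=> i; have /factor_theorem[g gE] : root (f i) 1 by apply/rootP.
  by exists (- g); rewrite fE gE exprSr; ring.
pose p := \sum_(i < m.+1) ((-1) ^+ i * (f i).[1] * (M i).[1]) *: 'X^(m.+1 - i).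
have p0 : p = 0.
  apply: pronic_roots_eq0 => n n0; have [K KE] := H n n0.
  have : \sum_(i < m.+1) (-1) ^+ i * 'X ^+ (i * n)
      * (qint 'X n * qint 'X n.+1) ^+ (m.+1 - i) * (f i * M i) = (1 - 'X) ^+ (E - e) * K.
    apply: (mulfI (expf_neq0 e subX_neq0)).
    rewrite mulrA -exprD subnKC 1?ltnW // -KE mulr_sumr; apply: eq_bigr => j _.
    have -> : ((1 - 'X ^+ n) * (1 - 'X ^+ n.+1)) ^+ (m.+1 - j) =
        (1 - 'X) ^+ (2 * (m.+1 - j)) * (qint 'X n * qint 'X n.+1) ^+ (m.+1 - j) :> {poly int}.
      by rewrite -!mul_qint mulrACA exprMn -expr2 -exprM.
    by transitivity ((-1) ^+ j * 'X ^+ (j * n) * (qint 'X n * qint 'X n.+1) ^+ (m.+1 - j)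
      * ((1 - 'X) ^+ (2 * (m.+1 - j)) * V j * M j)); [rewrite fE|]; ring.
  move/(congr1 (fun p => p.[1])); rewrite hornerM horner_exp !hornerE subrr.
  (* Since e < E, a factor 1 - q survives on the right and vanishes at 1. *)
  rewrite expr0n subn_eq0 leqNgt eE mul0r => S0; rewrite -[RHS]S0.
  rewrite /p !horner_sum; apply: eq_bigr => j _.
  by rewrite !hornerE !horner1_qint ?expr1n /=; ring.
have : p`_(m.+1 - i) = 0 by rewrite p0 coef0.
rewrite /p coef_sum (bigD1 i) //= big1 ?addr0 => [|j ji].
  rewrite coefZ coefXn eqxx mulr1 => /eqP.
  by rewrite !mulf_eq0 signr_eq0 (negPf (M0 _)) orbF => /eqP.
rewrite coefZ coefXn (_ : _ == _ = false) ?mulr0 //; apply/eqP => ij.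
case/eqP: ji; apply: val_inj => /=; have := ltn_ord i; have := ltn_ord j; lia.
Qed.

Lemma faulnum_dvd m r s : (r <= s <= m)%N -> exists W : {poly int},
  faulnum 'X m r s = (1 - 'X) ^+ (2 * s - 2 * r) * W.
Proof.
move=> /andP[rs sm].
(* Each summand over j shows 2m-2r+1 factors 1 - q, and the prefactor in [sum_faulnum] adds one.
   Removing 2(m+1-s) of them leaves 2s-2r. *)
have [||W WE] := @dvd_of_pronic_sums m (2 * m - 2 * r + 2) (faulnum 'X m r)
  (fun s => \prod_(s.+1 <= j < m.+1) qint 'X (m.+1 - j)) _ _ s sm.
- move=> i; rewrite horner_prod prodf_seq_neq0; apply/allP => j.
  by rewrite mem_index_iota horner1_qint pnatr_eq0 => /=; lia.
- move=> n n0; rewrite -sum_faulnum ?(leq_trans rs) //.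
  suff [K ->] : exists K, (\sum_(1 <= j < n.+1) (1 - 'X ^+ ((2 * r + 2) * j))
      * (1 - 'X ^+ j) ^+ (2 * m - 2 * r) * 'X ^+ (m.+1 * (n - j)) : {poly int}) =
      (1 - 'X) ^+ (2 * m - 2 * r + 1) * K.
    exists (\prod_(0 <= j < m.+1) qint 'X (m.+1 - j) * K).
    by rewrite [(1 - 'X) ^+ (_ + 2)]exprD [(1 - 'X) ^+ (_ + 1)]exprD expr1 expr2; ring.
  exists (\sum_(1 <= j < n.+1) qint 'X ((2 * r + 2) * j) * qint 'X j ^+ (2 * m - 2 * r)
     * 'X ^+ (m.+1 * (n - j))).
  rewrite mulr_sumr; apply: eq_bigr => j _.
  by rewrite -!mul_qint exprMn exprD expr1; ring.
exists W; apply: (mulfI (expf_neq0 (2 * (m.+1 - s)) subX_neq0)).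
by rewrite WE mulrA -exprD; congr (_ ^+ _ * _); lia.
Qed.

(** * Transfer from Z[q] to rational functions in q^(1/2), and the theorem *)

Fact evq_key : {ev : {rmorphism {poly int} -> RF} |
  forall p, ev p = (map_poly intr p).[qq]}.
Proof. by exists (horner_morph (fun x : int => mulrC qq x%:~R)). Qed.

(* Opaque, so that unification never computes in the field of fractions. *)
Definition evq := sval evq_key.

Lemma evqE p : evq p = (map_poly intr p).[qq]. Proof. exact: (svalP evq_key). Qed.

Lemma evqX : evq 'X = qq. Proof. by rewrite evqE map_polyX hornerX. Qed.

Lemma subqq_neq0 a : (0 < a)%N -> 1 - qq ^+ a != 0.
Proof.
move=> a0; rewrite /qq /qh -!tofracXn -tofrac1 -tofracB /= tofrac_eq0 -exprM.
by rewrite -opprB oppr_eq0 -size_poly_eq0 size_XnsubC // muln_gt0.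
Qed.

Lemma RF_natr_neq0 a : (0 < a)%N -> a%:R != 0 :> RF.
Proof.
move=> a0; rewrite -(rmorph_nat (@FracField.tofrac _)) tofrac_eq0.
by rewrite -polyC_natr polyC_eq0 pnatr_eq0 -lt0n.
Qed.

(** This is [mulrn_psi] for j = m+1-s and n = s-k, where (j+n)/j = (m-k+1)/(m-s+1); j is invertible
    in characteristic 0. *)
Lemma evq_psi m s k : (k <= s <= m)%N ->
  \sum_(i < (s - k).+1)
     ((m - k + 1)%:R / (m - s + 1)%:R
      * ('C(m - s + i, i))%:R * ('C(m - k - i, s - k - i))%:R
      * qq ^+ (s - k - i)) = evq (psi (m.+1 - s) (s - k) 1 'X).
Proof.
move=> /andP[ks sm]; have j0 : (0 < m.+1 - s)%N by rewrite subn_gt0.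
apply: (mulfI (RF_natr_neq0 j0)).
rewrite [RHS]mulr_natl -(rmorphMn evq) mulrn_psi rmorphMn rmorph_sum -[RHS]mulr_natl !mulr_sumr.
apply: eq_bigr => i _; have := ltn_ord i; rewrite ltnS => ik.
rewrite expr1n rmorphM !rmorphMn rmorph1 rmorphXn evqX.
rewrite (_ : m.+1 - s + (s - k) = m - k + 1)%N; last by lia.
rewrite (_ : (m.+1 - s + i).-1 = m - s + i)%N; last by lia.
rewrite (_ : (m.+1 - s + (s - k - i)).-1 = m - k - i)%N; last by lia.
rewrite (_ : m.+1 - s = m - s + 1)%N in j0 *; last by lia.
have cancel (F : fieldType) (a b c e : F) d : a != 0 ->
  a * (b / a * c * d%:R * e) = b * (c * (e *+ d)).
  by move=> a0; rewrite -[e *+ d]mulr_natr; field.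
by apply: cancel; apply: RF_natr_neq0.
Qed.

Lemma evq_qint a : (1 - qq) * evq (qint 'X a) = 1 - qq ^+ a.
Proof. by rewrite -evqX -(rmorph1 evq) -rmorphB -rmorphM mul_qint rmorphB rmorphXn. Qed.

Lemma evq_qint_neq0 a : (0 < a)%N -> evq (qint 'X a) != 0.
Proof.
by move/subqq_neq0; rewrite -evq_qint mulf_eq0 => /norP[].
Qed.

Lemma prod_subqq m s :
  \prod_(j < s.+1) (1 - qq ^+ (m.+1 - j)) =
  (1 - qq) ^+ s.+1 * evq (\prod_(0 <= j < s.+1) qint 'X (m.+1 - j)).
Proof.
rewrite big_mkord rmorph_prod -[X in _ ^+ X]card_ord -prodr_const -big_split /=.
by apply: eq_bigr => j _; rewrite evq_qint.
Qed.

Lemma expfz_sub (F : fieldType) (x : F) a b : x != 0 ->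
  x ^ (a%:Z - b%:Z) = x ^+ a / x ^+ b.
Proof. by move=> x0; rewrite expfzDr // -!exprnP -exprnN. Qed.

(** Of the s+1 factors 1 - q in the product, one cancels against 1 - q^(m+1-k). The total exponent
    s+2r-3s may be negative, hence the quotient. *)
Lemma P_msrE m s r : (s <= m)%N ->
  P_msr m s r = (1 - qq) ^+ (s + 2 * r) / (1 - qq) ^+ (3 * s) * evq (faulnum 'X m r s).
Proof.
move=> sm; have D0 : 1 - qq != 0 by rewrite -[qq]expr1 subqq_neq0.
rewrite /P_msr expfz_sub // prod_subqq /faulnum rmorph_sum !mulr_sumr.
apply: eq_bigr => k _; have := ltn_ord k; rewrite ltnS => ks.
rewrite evq_psi ?ks // !rmorphM rmorphXn rmorphN rmorph1 /= rmorph_int.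
rewrite big_mkord (bigD1 k) //= rmorphM -evq_qint.
rewrite big_mkord exprD exprS /cfaul rmorphB /= !rmorph_nat.
have cancel (F : fieldType) (x xs xr x3 e p c sg y : F) :
    [/\ x != 0, e != 0, xr != 0 & x3 != 0] ->
    x * xs * (e * p) / (x3 / xr) * (sg / (x * e) * c * y) = xs * xr / x3 * (sg * c * y * p).
  by case=> x0 e0 xr0 x30; field; rewrite ?x0 ?e0 ?xr0 ?x30.
by apply: cancel; split; rewrite ?expf_neq0 ?evq_qint_neq0 ?subn_gt0 // ltnS (leq_trans ks).
Qed.

Theorem theorem5p1 (m r n : nat) (hrm : (r <= m)%N) (hn : (1 <= n)%N) :
  (forall s : nat, (s <= m)%N ->
     exists p : {poly int}, P_msr m s r = (map_poly intr p).[qq])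
  /\
  S_mnr (2 * m - 2 * r + 1) n r =
  \sum_(k < m.+1)
    (-1) ^+ k * P_msr m k r
    * ((1 - qq ^+ n) ^+ (m.+1 - k) * (1 - qq ^+ n.+1) ^+ (m.+1 - k)
       * qq ^+ (k * n))
    / ((1 - qq ^+ (2 * r + 2)) * (1 - qq) ^ ((2 * m)%:Z - (3 * k)%:Z)
       * \prod_(i < k.+1) (1 - qq ^+ (m.+1 - i))).
Proof.
have D0 : 1 - qq != 0 by rewrite -[qq]expr1 subqq_neq0.
have evqD : evq (1 - 'X) = 1 - qq by rewrite rmorphB rmorph1 evqX.
split=> [s sm|].
  (* If r <= s, [faulnum_dvd] supplies the 2s-2r factors 1 - q missing from (1-q)^(s+2r); otherwise
     s+2r >= 3s already. *)
  have [W WE] : exists W : {poly int},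
      (1 - 'X) ^+ (s + 2 * r) * faulnum 'X m r s = (1 - 'X) ^+ (3 * s) * W.
    have [rs|sr] := leqP r s.
      have [|W ->] := @faulnum_dvd m r s; first by rewrite rs.
      by exists W; rewrite mulrA -exprD; congr (_ ^+ _ * _); lia.
    exists ((1 - 'X) ^+ (2 * r - 2 * s) * faulnum 'X m r s).
    by rewrite mulrA -exprD; congr (_ ^+ _ * _); lia.
  exists W; rewrite -evqE P_msrE // mulrAC -evqD -!(rmorphXn evq) -(rmorphM evq) WE.
  rewrite (rmorphM evq) mulrC; apply: mulKf.
  by rewrite (rmorphXn evq) evqD; apply: expf_neq0.
have B0 : 1 - qq ^+ (2 * r + 2) != 0 by rewrite subqq_neq0 // addn2.
have M0 a b : (b <= m.+1)%N -> evq (\prod_(a <= j < b) qint 'X (m.+1 - j)) != 0.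
  move=> bm; rewrite rmorph_prod prodf_seq_neq0; apply/allP => j.
  rewrite mem_index_iota => /andP[_ jb] /=.
  by rewrite evq_qint_neq0 // subn_gt0 (leq_trans jb).
have DE : (1 - qq) ^+ (2 * m) = (1 - qq) ^+ (2 * m - 2 * r) * (1 - qq) ^+ (2 * r).
  by rewrite -exprD subnK // leq_mul2l.
transitivity (evq ((1 - 'X) * \prod_(0 <= j < m.+1) qint 'X (m.+1 - j)
  * (\sum_(1 <= j < n.+1) (1 - 'X ^+ ((2 * r + 2) * j)) * (1 - 'X ^+ j) ^+ (2 * m - 2 * r)
     * 'X ^+ (m.+1 * (n - j)))) /
  ((1 - qq ^+ (2 * r + 2)) * (1 - qq) ^+ (2 * m - 2 * r).+1
     * evq (\prod_(0 <= j < m.+1) qint 'X (m.+1 - j)))).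
  rewrite rmorphM rmorph_sum /S_mnr mulr_sumr mulr_suml; apply: eq_bigr => j _.
  rewrite !rmorphM rmorphXn !rmorphB !rmorph1 /= !rmorphXn evqX addn1 subn1 /=.
  (* The exponent of q^(1/2) is even here, so only integral powers of q remain. *)
  rewrite (_ : (2 * m - 2 * r).+1 + 2 * r + 1 = 2 * m.+1)%N; last by lia.
  rewrite -mulnA [qh ^+ _]exprM -/qq expr_div_n exprS.
  have cancel (F : fieldType) (a b c x xe d p : F) : [/\ x != 0, xe != 0, d != 0 & p != 0] ->
      a / d * (b / xe) * c = x * p * (a * b * c) / (d * (x * xe) * p).
    by case=> x0 xe0 d0 p0; field; rewrite ?x0 ?xe0 ?d0 ?p0.
  exact: cancel (And4 D0 (expf_neq0 (2 * m - 2 * r)%N D0) B0 (M0 0%N m.+1 (leqnn _))).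
rewrite sum_faulnum // rmorph_sum mulr_suml; apply: eq_bigr => k _.
have km : (k <= m)%N by rewrite -ltnS.
rewrite (expfz_sub _ _ D0) prod_subqq (P_msrE r km).
(* Splitting the common denominator at k lets its tail j > k cancel against the one accompanying
   [faulnum]. *)
rewrite (big_cat_nat (leq0n k.+1) (ltn_ord k)) /= !(rmorphM evq) !(rmorphXn evq).
rewrite (rmorphM evq) (rmorphN evq) !(rmorphB evq) !(rmorphXn evq) (rmorph1 evq) evqX.
rewrite DE (exprMn (m.+1 - k) (1 - qq ^+ n)) (exprD (1 - qq) k).
rewrite (exprS (1 - qq) k) (exprS (1 - qq) (2 * m - 2 * r)).
have cancel (F : fieldType) (sg z u v c p p' b y x xk xr x3 : F) :
    [/\ b != 0, y != 0 & p != 0] -> [/\ p' != 0, x != 0, xk != 0, xr != 0 & x3 != 0] ->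
    sg * z * (u * v) * (c * p') / (b * (x * y) * (p * p')) =
    sg * (xk * xr / x3 * c) * (u * v * z) / (b * (y * xr / x3) * (x * xk * p)).
  case=> b0 y0 p0 [p'0 x0 xk0 xr0 x30].
  by field; rewrite ?b0 ?y0 ?p0 ?p'0 ?x0 ?xk0 ?xr0 ?x30.
exact: cancel (And3 B0 (expf_neq0 _ D0) (M0 0%N k.+1 (ltn_ord k)))
  (And5 (M0 k.+1 m.+1 (leqnn _)) D0 (expf_neq0 k D0) (expf_neq0 (2 * r)%N D0)
    (expf_neq0 (3 * k)%N D0)).
Qed.
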